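(* Let $d=d(n)$ be an integer-valued function of $n$ with $d(n)\ge 1$ for all $n$ and $d(n)=o(n^{1/3})$ as $n\to\infty$. Then there exists $N$ such that for all integers $n\ge N$, writing $d=d(n)$, for each graph $G\in\mathcal G_n(d)$ we have $$X(G)\le_s \max\{2,\,X(K^*_{d,n-d})\},$$ and if $\alpha(G)<n-d$ then $$X(G)\le_s X(K^*_{d,n-d}).$$
   Context: Graphs are finite and simple. For integers $n$ and $d\ge 0$, $\mathcal G_n(d)$ denotes the set of graphs with $n$ vertices and minimum degree at least $d$. $\alpha(G)$ is the independence number of $G$ (the maximum size of an independent set). $K^*_{a,b}$ denotes the graph obtained from the disjoint union of a complete graph on $a$ vertices and an edgeless graph on $b$ vertices by adding all edges between the two vertex sets. $X(G)$ denotes the random variable equal to the size of an independent set chosen uniformly at random from the set of all independent sets of $G$ (including the empty set). For real random variables $X,Y$, write $X\le_s Y$ ($X$ is stochastically dominated by $Y$) if $\mathbb P(X\le t)\ge\mathbb P(Y\le t)$ for each $t$. *)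

(* Defs.v *)
From HB Require Import structures.
From mathcomp Require Import all_boot all_order all_algebra.
From mathcomp Require Import all_classical all_reals all_analysis.

Set Implicit Arguments.
Unset Strict Implicit.
Unset Printing Implicit Defensive.

Import Order.TTheory GRing.Theory Num.Theory.

Local Open Scope ring_scope.

Record sgraph (V : finType) := SGraph {
  adj :> rel V;
  adj_sym : symmetric adj;
  adj_irrefl : irreflexive adj }.

Definition degree (V : finType) (G : sgraph V) (v : V) : nat :=
  #|[set u | G v u]|.

(* The class G_n(d). *)
Definition min_degree_class (n d : nat) (V : finType) (G : sgraph V) : Prop :=
  #|V| = n /\ forall v : V, (d <= degree G v)%N.

Definition independent (V : finType) (G : sgraph V) : pred {set V} :=
  fun S => [forall u in S, forall v in S, ~~ G u v].

Definition independence_number (V : finType) (G : sgraph V) : nat :=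
  \max_(S : {set V} | independent G S) #|S|.

Section Kstar.
Variables a b : nat.

Definition kstar_adj (x y : 'I_a + 'I_b) : bool :=
  match x, y with
  | inl i, inl j => i != j
  | inr _, inr _ => false
  | _, _ => true
  end.

Lemma kstar_adj_sym : symmetric kstar_adj.
Proof. by move=> [i|i] [j|j] //=; rewrite eq_sym. Qed.

Lemma kstar_adj_irrefl : irreflexive kstar_adj.
Proof. by move=> [i|i] //=; rewrite eqxx. Qed.

(* K*_{a,b}: the join of a complete graph on [a] vertices and an edgeless graph
   on [b] vertices. *)
Definition kstar : sgraph ('I_a + 'I_b)%type :=
  SGraph kstar_adj_sym kstar_adj_irrefl.
End Kstar.

(* The sample space of all independent sets of [G]; it always contains the
   empty set. *)
Definition indep_set (V : finType) (G : sgraph V) : finType :=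
  {S : {set V} | independent G S}.

(* Probability of an event under the uniform distribution on a (nonempty)
   finite sample space. *)
Definition unif_pr (R : realType) (Omega : finType) (E : pred Omega) : R :=
  #|E|%:R / #|Omega|%:R.
Arguments unif_pr : clear implicits.

(* [X(G)]: the size of a uniformly random independent set. *)
Definition indep_size (R : realType) (V : finType) (G : sgraph V)
    (S : indep_set G) : R := #|val S|%:R.
Arguments indep_size R {V} G S.

(* [X <=_s Y], for real random variables on two uniform finite sample spaces. *)
Definition stoch_le (R : realType) (Omega1 Omega2 : finType)
    (X : Omega1 -> R) (Y : Omega2 -> R) : Prop :=
  forall t : R, unif_pr R Omega2 [pred w | Y w <= t]
             <= unif_pr R Omega1 [pred w | X w <= t].

(* Main.v *)
(** Write [a k] and [b k] for the numbers of independent sets of size [k] in [G]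
    and in K*_{d,n-d}. An independent set of size [k > 0] in [G] has at most
    [n - d - k] one-point extensions, while [b k = C(n-d,k)] for [k > 1], so
    [a k / b k] is nonincreasing on [k > 1].

    If alpha(G) < n-d, then, as [a 0 = b 0] and [a 1 = b 1], it suffices to
    compare the totals i(G) and i(K*_{d,n-d}) >= 2^(n-d). Either [G] has [3 d] disjoint
    edges, and i(G) <= 2^n (3/4)^(3d); or all but [6 d] vertices form an
    independent set, and then, [n] being large compared to [d^2], at least [d]
    vertices have degree at least [2 d]. The few independent sets meeting them
    are negligible. If there are [d+1] of them, at most 2^(n-d-1) independent
    sets avoid these; if there are exactly [d], at most (3/4) 2^(n-d) do, since
    the remaining [n - d] vertices span an edge.

    If alpha(G) = n-d, then [G] is the join of an edgeless graph on [n - d]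
    vertices with a graph [H] on [d] vertices, so [a k = b k + h k] where the numbers [h k] of
    independent sets of [H] decrease much faster than the [b k]. *)

Require Import Defs.
From mathcomp Require Import all_boot all_order all_algebra.
From mathcomp Require Import zify.

Set Implicit Arguments.
Import Order.TTheory GRing.Theory Num.Theory.

(** * Heads and tails of sequences *)

Lemma sum_mul_cross (c : nat) (a b : nat -> nat) (r s u v : nat) :
  (forall k l, r <= k < s -> u <= l < v -> c * (b k * a l) <= a k * b l) ->
  c * ((\sum_(r <= k < s) b k) * (\sum_(u <= l < v) a l))
  <= (\sum_(r <= k < s) a k) * (\sum_(u <= l < v) b l).
Proof.
move=> ab; rewrite !big_distrl big_distrr /= big_nat_cond [leqRHS]big_nat_cond.
apply: leq_sum => k /andP[hk _]; rewrite !big_distrr /= big_nat_cond [leqRHS]big_nat_cond.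
by apply: leq_sum => l /andP[hl _]; exact: ab.
Qed.

Lemma sum_head2 (f : nat -> nat) (t : nat) : 0 < t ->
  \sum_(0 <= k < t.+1) f k = f 0 + f 1 + \sum_(2 <= k < t.+1) f k.
Proof. by move=> t0; rewrite big_ltn // big_ltn // addnA. Qed.

(** The conclusion is the comparison of distribution functions at [t] with denominators cleared. If
    [b l < a l] for some [l > t], the cross inequality forces [b k <= a k] for [2 <= k <= t], so the
    head of [a] is the larger one and the totals make its tail the smaller one; otherwise the tails
    compare termwise. The tail bound settles indices 0 and 1, the cross inequality the rest of the
    head. *)
Lemma head_tail_cross_of_total (a b : nat -> nat) (M t : nat) :
  a 0 = b 0 -> a 1 = b 1 ->
  (forall k l, 2 <= k <= l -> b k * a l <= a k * b l) ->
  \sum_(0 <= k < M) a k <= \sum_(0 <= k < M) b k ->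
  t < M ->
  (\sum_(0 <= k < t.+1) b k) * (\sum_(t.+1 <= l < M) a l)
  <= (\sum_(0 <= k < t.+1) a k) * (\sum_(t.+1 <= l < M) b l).
Proof.
move=> a0 a1 cross total tM.
have tail : \sum_(t.+1 <= l < M) a l <= \sum_(t.+1 <= l < M) b l.
  have [/hasP[l]|/hasPn small] := boolP (has (fun l => b l < a l) (index_iota t.+1 M)).
    rewrite mem_index_iota => /andP[tl lM] ba.
    have head : \sum_(0 <= k < t.+1) b k <= \sum_(0 <= k < t.+1) a k.
      rewrite big_nat_cond [leqRHS]big_nat_cond.
      apply: leq_sum => -[|[|k]] /andP[kt _]; rewrite ?a0 ?a1 //.
      have := cross k.+2 l; nia.
    move: total; rewrite (@big_cat_nat _ _ _ t.+1) //= (@big_cat_nat _ _ _ t.+1 0 M) //=.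
    by lia.
  rewrite big_nat_cond [leqRHS]big_nat_cond; apply: leq_sum => l /andP[hl _].
  by rewrite leqNgt; apply: small; rewrite mem_index_iota.
case: t => [|t] in tM tail *; first by rewrite !big_nat1 a0 leq_mul2l tail orbT.
rewrite !sum_head2 // a0 a1.
rewrite [leqLHS]mulnDl [leqRHS]mulnDl; apply: leq_add; first by rewrite leq_mul2l tail orbT.
rewrite -[leqLHS]mul1n; apply: sum_mul_cross => k l /andP[k2 kt] /andP[tl _].
by rewrite mul1n; apply: cross; lia.
Qed.

(** After cancellation, what remains is that the whole head of [b] times the tail of [h] is at most
    the head of [h] times the tail of [b]. The factor 2 in the hypothesis pays for indices 0 and 1,
    since [b 0 + b 1 <= b 2]. The excess [h] enters only from index 2 on, whence [1 < t]. *)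
Lemma head_tail_cross_of_excess (a b h : nat -> nat) (M t : nat) :
  a 0 = b 0 -> a 1 = b 1 -> (forall k, 1 < k -> a k = b k + h k) ->
  b 0 + b 1 <= b 2 ->
  (forall k l, 2 <= k < l -> 2 * (b k * h l) <= h k * b l) ->
  1 < t ->
  (\sum_(0 <= k < t.+1) b k) * (\sum_(t.+1 <= l < M) a l)
  <= (\sum_(0 <= k < t.+1) a k) * (\sum_(t.+1 <= l < M) b l).
Proof.
move=> a0 a1 abh b2 cross t1.
have aE r s : 1 < r -> \sum_(r <= k < s) a k
    = \sum_(r <= k < s) b k + \sum_(r <= k < s) h k.
  move=> r1; rewrite -big_split; apply: eq_big_nat => k /andP[rk _].
  by apply: abh; exact: leq_trans rk.
have : 2 * ((\sum_(2 <= k < t.+1) b k) * (\sum_(t.+1 <= l < M) h l))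
    <= (\sum_(2 <= k < t.+1) h k) * (\sum_(t.+1 <= l < M) b l).
  by apply: sum_mul_cross => k l *; apply: cross; lia.
have b2h : b 2 <= \sum_(2 <= k < t.+1) b k by rewrite big_ltn ?leq_addr.
rewrite !sum_head2 ?(ltnW t1) // a0 a1.
rewrite !aE; [|lia..].
set B := \sum_(2 <= k < t.+1) b k in b2h *; set H := \sum_(2 <= k < t.+1) h k.
set B' := \sum_(t.+1 <= l < M) b l; set H' := \sum_(t.+1 <= l < M) h l.
move=> le.
have : (b 0 + b 1) * H' <= B * H' by rewrite leq_mul2r (leq_trans b2) ?orbT.
nia.
Qed.

(** Compare the growth factors [r l / l.+1] and [s l / l.+1]. The step from [k] to [k.+1] gains the
    factor [c]; later steps only have to preserve it, for which [r l <= s l] suffices. *)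
Lemma ratio_cross (c : nat) (a b r s : nat -> nat) (k : nat) :
  0 < c ->
  (forall l, k <= l -> l.+1 * a l.+1 <= r l * a l) ->
  (forall l, k <= l -> l.+1 * b l.+1 = s l * b l) ->
  (forall l, k <= l -> c * r l <= s l) ->
  forall l, k < l -> c * (b k * a l) <= a k * b l.
Proof.
move=> c_gt0 ha hb rs.
have step l x y : k <= l -> x * (r l * a l) <= y * (s l * b l) ->
    x * a l.+1 <= y * b l.+1.
  move=> kl xy; rewrite -(@leq_pmul2l l.+1) // mulnCA (mulnCA _ y) hb //.
  by apply: leq_trans xy; rewrite leq_mul2l ha ?orbT.
elim=> // l IH; rewrite ltnS leq_eqVlt mulnA => /predU1P[<-|kl].
- apply: step => //.
  by have := leq_mul (rs k (leqnn k)) (leqnn (a k * b k)); lia.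
- apply: step; first exact: ltnW.
  have rs_l : r l <= s l by apply: leq_trans (rs l (ltnW kl)); rewrite leq_pmull.
  by have := leq_mul (IH kl) rs_l; lia.
Qed.
(** * Counting independent sets *)

Section IndependentSets.
Variables (V : finType) (G : sgraph V).
Implicit Types (S T U W J : {set V}) (u v : V).

(** Restricting to subsets of [W] plays the role of passing to induced subgraphs, so vertices can be
    deleted without changing the type [V]. *)
Definition indeps W : {set {set V}} :=
  [set S : {set V} | (S \subset W) && independent G S].

Definition count_indep W k := #|[set S in indeps W | #|S| == k]|.

Lemma independentP S :
  reflect {in S &, forall u v, ~~ G u v} (independent G S).
Proof.
apply: (iffP forall_inP) => [indS u v uS vS|indS u uS].
  by have /forall_inP := indS u uS; exact.
by apply/forall_inP => v vS; exact: indS.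
Qed.

Lemma independentS S T : S \subset T -> independent G T -> independent G S.
Proof.
move=> /subsetP ST /independentP indT; apply/independentP => u v uS vS.
by apply: indT; exact: ST.
Qed.

Lemma indepsD W S T : S \in indeps W -> S :\: T \in indeps (W :\: T).
Proof.
rewrite !inE => /andP[SW indS]; rewrite setSD //=.
exact: independentS (subsetDl _ _) indS.
Qed.

Lemma card_indeps_le W : #|indeps W| <= 2 ^ #|W|.
Proof.
by rewrite -card_powerset; apply/subset_leq_card/subsetP => S; rewrite !inE => /andP[].
Qed.

Lemma setD1_inj v S T : v \in S -> v \in T -> S :\ v = T :\ v -> S = T.
Proof. by move=> vS vT eqST; rewrite -(setD1K vS) eqST setD1K. Qed.

(** Apart from [v] itself, such a set avoids the closed neighbourhood of [v]. *)
Lemma card_indeps_mem v :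
  #|[set S in indeps setT | v \in S]| <= 2 ^ (#|V| - (degree G v).+1).
Proof.
have -> : #|V| - (degree G v).+1 = #|~: (v |: [set u | G v u])|.
  by rewrite cardsCs setCK cardsU1 inE adj_irrefl.
rewrite -card_powerset -[leqLHS](card_in_imset (f := fun S => S :\ v)).
  apply/subset_leq_card/subsetP => _ /imsetP[S + ->].
  rewrite !inE => /andP[/andP[_ /independentP indS] vS].
  apply/subsetP => u; rewrite !inE => /andP[uv uS].
  by rewrite negb_or uv indS.
by move=> S T; rewrite !inE => /andP[_ vS] /andP[_ vT]; exact: setD1_inj.
Qed.

(** An independent set meets the edge in the empty set, in [u] alone or in [v] alone, and is
    determined by this trace together with its part off the edge. *)
Lemma card_indeps_edge W u v : G u v ->
  #|indeps W| <= 3 * #|indeps (W :\: [set u; v])|.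
Proof.
move=> uv; pose E := [set u; v].
pose X := [set set0; [set u]; [set v]].
have cardX : #|X| <= 3.
  by apply: leq_trans (leq_card_setU _ _) _; rewrite cards2 cards1; case: (_ != _).
apply: (leq_trans _ (leq_mul cardX (leqnn _))); rewrite -cardsX.
rewrite -[leqLHS](card_imset (f := fun S => (S :&: E, S :\: E))); last first.
  by move=> S T [eqI eqD]; rewrite -(setID S E) eqI eqD setID.
apply/subset_leq_card/subsetP => _ /imsetP[S SW ->]; rewrite in_setX indepsD // andbT.
move: SW; rewrite inE => /andP[_ /independentP indS].
have [uS|uS] := boolP (u \in S); have [vS|vS] := boolP (v \in S).
- by rewrite (negPf (indS _ _ uS vS)) in uv.
- rewrite !inE; suff -> : S :&: E = [set u] by rewrite eqxx orbT.
  apply/setP => w; rewrite !inE; case: eqVneq => [->|_]; rewrite ?uS //=.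
  by case: eqVneq => [->|_]; rewrite ?(negPf vS) ?andbF.
- rewrite !inE; suff -> : S :&: E = [set v] by rewrite eqxx orbT.
  apply/setP => w; rewrite !inE orbC.
  case: eqVneq => [->|_]; rewrite ?vS //=.
  by case: eqVneq => [->|_]; rewrite ?(negPf uS) ?andbF.
- rewrite !inE; suff -> : S :&: E = set0 by rewrite eqxx.
  apply/setP => w; rewrite !inE; case: eqVneq => [->|_]; first by rewrite (negPf uS).
  by case: eqVneq => [->|_]; rewrite ?(negPf vS) ?andbF.
Qed.

Lemma edge_of_dependent W : ~~ independent G W ->
  exists u v, [/\ G u v, [set u; v] \subset W & #|[set u; v]| = 2].
Proof.
case/forall_inPn => u uW /forall_inPn[v vW]; rewrite negbK => uv.
exists u, v; split=> //; first by rewrite subUset !sub1set uW.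
by rewrite cards2; case: eqVneq uv => // ->; rewrite adj_irrefl.
Qed.

Lemma card_indeps_dependent W : ~~ independent G W ->
  4 * #|indeps W| <= 3 * 2 ^ #|W|.
Proof.
move=> /edge_of_dependent[u [v [uv uvW card2]]].
have := card_indeps_edge W _ _ uv; have := card_indeps_le (W :\: [set u; v]).
have W2 : 2 <= #|W| by rewrite -card2 subset_leq_card.
rewrite cardsD (setIidPr uvW) card2 -(subnK W2) addnK addn2 !expnS; lia.
Qed.

(* Greedily removing disjoint edges, each of which costs a factor 3/4. *)
Lemma card_indeps_or_independentD m W :
  4 ^ m * #|indeps W| <= 3 ^ m * 2 ^ #|W| \/
  exists J, #|J| <= m.*2 /\ independent G (W :\: J).
Proof.
elim: m W => [|m IH] W; first by left; rewrite !mul1n card_indeps_le.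
have [indW|] := boolP (independent G W).
  by right; exists set0; rewrite cards0 setD0.
move=> /edge_of_dependent[u [v [uv uvW card2]]].
have W2 : 2 <= #|W| by rewrite -card2 subset_leq_card.
case: (IH (W :\: [set u; v])) => [le|[J [cardJ indJ]]]; last first.
  right; exists ([set u; v] :|: J); rewrite -setDDl; split=> //.
  by apply: leq_trans (leq_card_setU _ _) _; rewrite card2; lia.
left; have := card_indeps_edge W _ _ uv; rewrite cardsD (setIidPr uvW) card2 in le.
rewrite -(subnK W2) addn2 !expnS => le3.
have := leq_mul (leqnn (4 ^ m)) le3; lia.
Qed.

Lemma card_bigcup_le (I : finType) (T : finType) (A : {set I}) (F : I -> {set T}) :
  #|\bigcup_(i in A) F i| <= \sum_(i in A) #|F i|.
Proof.
elim/big_rec2: _ => [|i m B _ le]; first by rewrite cards0.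
by apply: leq_trans (leq_card_setU _ _) _; rewrite leq_add2l.
Qed.

(** Union bound: an independent set that does not avoid [U] contains some vertex of [U], and
    [card_indeps_mem] limits the sets through each one. *)
Lemma card_indeps_cover U (D : nat) : {in U, forall v, D <= degree G v} ->
  #|indeps setT| <= #|indeps (~: U)| + #|U| * 2 ^ (#|V| - D.+1).
Proof.
move=> degU.
have sub : indeps setT \subset
    indeps (~: U) :|: \bigcup_(v in U) [set S in indeps setT | v \in S].
  apply/subsetP => S SV; rewrite in_setU.
  have [//|] := boolP (S \in indeps (~: U)); move: (SV).
  rewrite !inE subsetT /= => -> /=; rewrite andbT => /subsetPn[v vS].
  by rewrite inE negbK => vU; apply/bigcupP; exists v => //; rewrite inE SV vS.
apply: leq_trans (subset_leq_card sub) _.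
apply: leq_trans (leq_card_setU _ _) _; rewrite leq_add2l.
apply: leq_trans (card_bigcup_le _ _) _.
rewrite -sum_nat_const; apply: leq_sum => v vU.
by apply: leq_trans (card_indeps_mem v) _; rewrite leq_exp2l // leq_sub2l // ltnS degU.
Qed.


Lemma independence_number_ge S : independent G S -> #|S| <= independence_number G.
Proof. by move=> indS; exact: (leq_bigmax_cond (F := fun S : {set V} => #|S|)). Qed.

Lemma independent_max : exists2 S, independent G S & #|S| = independence_number G.
Proof.
have ind0 : independent G set0 by apply/independentP => u v; rewrite inE.
have ne : 0 < #|independent G| by apply/card_gt0P; exists set0.
by have [S indS maxS] := eq_bigmax_cond (fun S : {set V} => #|S|) ne; exists S.
Qed.

Lemma exists_subset_card U k : k <= #|U| ->
  exists2 T : {set V}, T \subset U & #|T| = k.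
Proof.
move=> kU; exists [set v in take k (enum U)].
  by apply/subsetP => v; rewrite inE => /mem_take; rewrite mem_enum.
by rewrite cardsE (card_uniqP _) ?take_uniq ?enum_uniq // size_takel // -cardE.
Qed.

(** * Graphs of minimum degree at least d *)

Section MinDegree.
Variable d : nat.
Hypotheses (deg_ge : forall v, d <= degree G v).

Lemma neighbours_independent S v : independent G S -> v \in S ->
  [set u | G v u] \subset ~: S.
Proof.
move=> /independentP indS vS; apply/subsetP => u; rewrite !inE => vu.
by apply: contraL vu => uS; exact: indS.
Qed.

(** The neighbours of a vertex outside [J] all lie in [J]. If fewer than [d] vertices had degree at
    least [D], each vertex outside [J] would have a neighbour in [J] of degree below [D], leaving at
    most [#|J| * D] vertices outside [J]. *)
Lemma card_high_degree J D : independent G (~: J) -> 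
  #|J| + #|J| * D < #|V| -> d <= #|[set v | D <= degree G v]|.
Proof.
set U := [set v | _]; move=> indJ; apply: contraLR; rewrite -leqNgt -ltnNge => Ud.
have sub : ~: J \subset \bigcup_(w in J :\: U) [set v | G w v].
  apply/subsetP => v vJ; have := neighbours_independent indJ vJ; rewrite setCK => nJ.
  have : ~~ ([set u | G v u] \subset U).
    by apply: contraL (deg_ge v) => /subset_leq_card le; rewrite -ltnNge (leq_ltn_trans le).
  case/subsetPn => w vw wU; apply/bigcupP; exists w.
    by rewrite inE wU (subsetP nJ).
  by move: vw; rewrite !inE adj_sym.
rewrite -(cardsC J) leq_add2l.
apply: leq_trans (subset_leq_card sub) _; apply: leq_trans (card_bigcup_le _ _) _.
apply: (@leq_trans (\sum_(w in J :\: U) D)).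
  by apply: leq_sum => w; rewrite !inE -ltnNge => /andP[/ltnW].
by rewrite sum_nat_const leq_mul2r subset_leq_card ?subsetDl ?orbT.
Qed.

Lemma card_indeps_le_exp : 0 < d -> 18 * d ^ 2 < #|V| ->
  independence_number G < #|V| - d -> #|indeps setT| <= 2 ^ (#|V| - d).
Proof.
move=> d0 dV alpha.
have [I_le|[J [cardJ]]] := card_indeps_or_independentD (3 * d) setT.
  (* Three disjoint edges cost a factor 27/64, which is below 1/2 as 2 * 27 = 54 < 64; so 3d of them
     bring 2^n down to 2^(n-d). *)
  have le54 : 54 ^ d <= 64 ^ d by rewrite leq_exp2r.
  have dV' : d <= #|V| by nia.
  rewrite !expnM cardsT in I_le.
  have := leq_mul le54 (leqnn #|indeps setT|).
  have -> : 54 ^ d = 27 ^ d * 2 ^ d by rewrite -expnMn.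
  rewrite -{1}(subnK dV') expnD in I_le.
  move=> le; have {le} := leq_trans le I_le; rewrite -mulnA [2 ^ _ * 2 ^ d]mulnC.
  by rewrite !leq_pmul2l ?expn_gt0.
(* [P] bounds the number of independent sets through one vertex of degree at least 2d. *)
rewrite setTD => indJ; set P := 2 ^ (#|V| - (2 * d).+1).
have Pexp k : k <= 2 * d -> 2 ^ (#|V| - k.+1) = 2 ^ (2 * d - k) * P.
  by move=> kd; rewrite -expnD; congr (2 ^ _); nia.
pose U := [set v | 2 * d <= degree G v].
(* As [#|J|] is at most 6d, the quantity to bound is at most 6d + 12d^2 <= 18d^2, the source of the
   constant 18. *)
have dU : d <= #|U| by apply: card_high_degree indJ _; nia.
have high U' : U' \subset U -> #|indeps setT| <= #|indeps (~: U')| + #|U'| * P.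
  by move=> /subsetP U'U; apply: card_indeps_cover => v /U'U; rewrite inE.
have := ltn_expl d (ltnSn 1); set p := 2 ^ d => dp.
have pV : 2 ^ (#|V| - d) = 2 * p * P.
  by rewrite -expnS -expnD; congr (2 ^ _); nia.
(* With d+1 vertices of high degree the bound is p P + (d+1) P, and d+1 <= p = 2^d. *)
have [dU'|Ud] := ltnP d #|U|.
  have [U' U'U cardU'] := exists_subset_card _ _ dU'.
  apply: leq_trans (high _ U'U) _; rewrite cardU' pV.
  have := card_indeps_le (~: U'); rewrite [#|~: U'|]cardsCs setCK cardU' Pexp; last by lia.
  rewrite mul2n -addnn addnK -/p => le.
  have := leq_mul dp (leqnn P); lia.
(* With exactly d, the n-d remaining vertices cannot be independent, so they contribute at most
   (3/2) p P; the rest is d P <= p P / 2. *)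
have cardU : #|U| = d by apply/eqP; rewrite eqn_leq dU Ud.
apply: leq_trans (high U _) _ => //; rewrite cardU.
have : ~~ independent G (~: U).
  apply: contraL alpha => indU; rewrite -leqNgt -{1}cardU -cardsT -cardsDS ?subsetT //.
  by rewrite setTD independence_number_ge.
move=> /card_indeps_dependent; rewrite [#|~: U|]cardsCs setCK cardU pV.
have : 2 * d <= p.
  rewrite /p; case: (d) d0 => // k _; rewrite expnS leq_mul2l /=; exact: ltn_expl.
move=> dp2; have := leq_mul dp2 (leqnn P); lia.
Qed.

(** Double counting of pairs (S, v) with v in S and S independent of size k+1: removing v leaves an
    independent k-set that v extends. *)
Lemma card_indeps_succ W k r :
  (forall S, S \in indeps W -> #|S| = k ->
     #|[set v in W :\: S | independent G (v |: S)]| <= r) ->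
  k.+1 * count_indep W k.+1 <= r * count_indep W k.
Proof.
move=> ext; pose A k := [set S in indeps W | #|S| == k].
have -> : k.+1 * count_indep W k.+1 = \sum_(S in A k.+1) \sum_(v in S) 1.
  rewrite mulnC -sum_nat_const; apply: eq_bigr => S.
  by rewrite sum1_card inE => /andP[_ /eqP].
rewrite (exchange_big_dep predT) //=.
pose E S := [set v in W :\: S | independent G (v |: S)].
apply: (@leq_trans (\sum_v \sum_(S in A k | v \in E S) 1)).
  apply: leq_sum => v _; rewrite !sum1dep_card.
  rewrite -[leqLHS](card_in_imset (f := fun S => S :\ v)); last first.
    by move=> S T; rewrite !inE => /andP[_ vS] /andP[_ vT]; exact: setD1_inj.
  apply/subset_leq_card/subsetP => _ /imsetP[S + ->].
  rewrite !inE => /andP[/andP[/andP[SW indS] /eqP cardS] vS].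
  rewrite eqxx /= setD1K // indS (subsetP SW) // andbT (subset_trans (subsetDl _ _)) //=.
  rewrite (independentS (subsetDl _ _) indS) /=.
  by rewrite andbT; move: cardS; rewrite (cardsD1 v) vS add1n => -[] /eqP.
rewrite (exchange_big_dep (mem (A k))) /=; last by move=> ? ? _ /andP[].
rewrite mulnC -sum_nat_const; apply: leq_sum => S SA.
move: (SA); rewrite inE => /andP[SW /eqP cardS].
apply: leq_trans (ext S SW cardS); rewrite sum1dep_card subset_leq_card //.
by apply/subsetP => v; rewrite in_set => /andP[].
Qed.

(** For [u] in [S], which exists as [k > 0], the set [S], the vertices extending it and the at least
    [d] neighbours of [u] are pairwise disjoint. *)
Lemma count_indep_succ k : 0 < k ->
  k.+1 * count_indep setT k.+1 <= (#|V| - d - k) * count_indep setT k.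
Proof.
move=> k0; apply: card_indeps_succ => S; rewrite inE => /andP[_ indS] cardS.
have [u uS] : exists u, u \in S by apply/card_gt0P; rewrite cardS.
have nS := neighbours_independent indS uS.
set E := [set v in _ | _].
have SE : S :&: E = set0.
  by apply/setP => v; rewrite !inE; case: (v \in S).
have nSE : [set v | G u v] :&: (S :|: E) = set0.
  apply/setP => v; rewrite !inE; apply/negP => /andP[uv /orP[vS|]].
    by have := subsetP nS v; rewrite !inE uv vS => /(_ isT).
  case/andP => _ /independentP /(_ u v).
  by rewrite !inE eqxx uS orbT uv => /(_ isT isT).
have := max_card (mem ([set v | G u v] :|: (S :|: E))).
rewrite !cardsU nSE SE !cards0 !subn0 cardS; have := deg_ge u; rewrite /degree.
lia.
Qed.

Lemma count_indep_succ_sub W k :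
  k.+1 * count_indep W k.+1 <= (#|W| - k) * count_indep W k.
Proof.
apply: card_indeps_succ => S; rewrite inE => /andP[SW _] <-.
rewrite -(cardsDS SW); apply: subset_leq_card; apply/subsetP => v.
by rewrite inE => /andP[].
Qed.

(** Each vertex of [S] has at least [d] neighbours, all among the [d] vertices outside [S], so it is
    joined to all of these. An independent set thus lies in [S] or in its complement, and in only
    one of them when [k > 0]. *)
Lemma count_indep_extremal S k : independent G S -> #|S| = #|V| - d -> d < #|V| ->
  0 < k -> count_indep setT k = 'C(#|V| - d, k) + count_indep (~: S) k.
Proof.
move=> indS cardS dV k0.
have nS u : u \in S -> [set v | G u v] = ~: S.
  move=> uS; apply/eqP; rewrite eqEcard neighbours_independent //.
  by rewrite cardsCs setCK cardS subKn ?(ltnW dV) // deg_ge.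
rewrite -cardS -cards_draws /count_indep -cardsUI.
set I := _ :&: _; have -> : I = set0.
  apply/setP => T; rewrite !inE; apply/negP => /andP[/andP[TS /eqP cT] /andP[/andP[TC _] _]].
  move: k0; rewrite -cT => /card_gt0P[v vT].
  by have := subsetP TC v vT; rewrite inE (subsetP TS v vT).
rewrite cards0 addn0; congr #|pred_of_set _|; apply/setP => T; rewrite !inE subsetT /=.
case: (#|T| == k); rewrite ?andbF ?andbT //.
apply/idP/orP => [indT|[TS|/andP[]//]]; last exact: independentS TS indS.
have [TS|/subsetPn[v vT vS]] := boolP (T \subset S); first by left.
right; rewrite indT andbT; apply/subsetP => u uT; rewrite inE; apply/negP => uS.
have /setP/(_ v) := nS u uS; rewrite !inE vS.
by move/independentP: indT => /(_ u v uT vT) /negPf ->.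
Qed.

Lemma independence_number_le : 0 < #|V| -> independence_number G <= #|V| - d.
Proof.
move=> V0; have [S indS <-] := independent_max.
have [->|/set0Pn[v vS]] := eqVneq S set0; first by rewrite cards0.
have := subset_leq_card (neighbours_independent indS vS).
have := deg_ge v; rewrite /degree [#|~: S|]cardsCs setCK.
by have := subset_leq_card (subsetT S); rewrite cardsT; lia.
Qed.

End MinDegree.

Lemma count_indep0 : count_indep setT 0 = 1.
Proof.
rewrite /count_indep -(cards1 (set0 : {set V})); congr #|pred_of_set _|.
apply/setP => S; rewrite !inE subsetT cards_eq0 /= andb_idl // => /eqP ->.
by apply/independentP => u v; rewrite inE.
Qed.


Lemma count_indep1 : count_indep setT 1 = #|V|.
Proof.
rewrite -[RHS]bin1 -cardsT -cards_draws; apply: eq_card => S; rewrite !inE -andbA.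
congr andb; rewrite andb_idl // => /cards1P[v ->]; apply/independentP => x y.
by rewrite !inE => /eqP-> /eqP->; rewrite adj_irrefl.
Qed.

Lemma card_indeps_lt m :
  #|[set S in indeps setT | #|S| < m]| = \sum_(0 <= k < m) count_indep setT k.
Proof.
elim: m => [|m IH]; first by rewrite big_geq // eq_card0 // => S; rewrite inE ltn0 andbF.
rewrite big_nat_recr //= -IH -[LHS](cardsID [set S : {set V} | #|S| < m]); congr (_ + _);
  apply: eq_card => S; rewrite !inE -andbA; lia.
Qed.

Lemma card_indeps M : #|V| < M ->
  #|indeps setT| = \sum_(0 <= k < M) count_indep setT k.
Proof.
move=> VM; rewrite -card_indeps_lt; apply: eq_card => S; rewrite [RHS]inE.
by rewrite (leq_ltn_trans (max_card _) VM) andbT.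
Qed.

Lemma card_indep_set (P : pred {set V}) :
  #|[pred S : indep_set G | P (val S)]| = #|[set S in indeps setT | P S]|.
Proof.
rewrite -(card_imset _ val_inj); apply: eq_card => S; apply/imsetP/idP.
  by case=> T; rewrite !inE => PT ->; rewrite subsetT PT andbT; exact: valP.
rewrite !inE subsetT => /andP[indS PS].
by exists (Sub S indS); rewrite ?inE ?SubK.
Qed.

End IndependentSets.

(** * Independent sets of K*_{d,m} *)

Section KstarCount.
Variables d m : nat.

Let side : {set 'I_d + 'I_m} := [set x | ~~ is_inl x].

Lemma card_side : #|side| = m.
Proof.
rewrite -[RHS]card_ord -(card_imset _ (@inr_inj 'I_d 'I_m)).
apply: eq_card => -[i|i]; rewrite !inE /=; apply/esym.
  by apply/imsetP => -[].
by apply/imsetP; exists i.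
Qed.

Lemma independent_side (S : {set 'I_d + 'I_m}) :
  S \subset side -> independent (kstar d m) S.
Proof.
move=> /subsetP Sside; apply/independentP => -[i|i] [j|j] xS yS //=;
  by have := Sside _ xS; have := Sside _ yS; rewrite !inE.
Qed.

(** A vertex of the clique side is adjacent to all others, so it occurs in no independent set other
    than its singleton. *)
Lemma count_indep_kstar k : 1 < k ->
  count_indep (kstar d m) setT k = 'C(m, k).
Proof.
move=> k1; rewrite -[in RHS]card_side -cards_draws; apply: eq_card => S; rewrite !inE subsetT /=.
apply: andb_id2r => /eqP cardS; apply/idP/idP; last exact: independent_side.
move=> /independentP indS; apply/subsetP => -[i iS|i _]; last by rewrite inE.
have : 0 < #|S :\ inl i| by move: k1; rewrite -cardS (cardsD1 (inl i)) iS.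
move=> /card_gt0P[y]; rewrite !inE => /andP[yi yS].
have := indS _ _ iS yS; case: y yi {yS} => [j|j] //=.
by rewrite (inj_eq inl_inj) eq_sym => ->.
Qed.

Lemma card_indeps_kstar_ge : 2 ^ m <= #|indeps (kstar d m) setT|.
Proof.
rewrite -[in leqLHS]card_side -card_powerset; apply/subset_leq_card/subsetP => S.
by rewrite !inE subsetT; exact: independent_side.
Qed.

End KstarCount.

Lemma card_kstar_vertices n d : d <= n -> #|{: 'I_d + 'I_(n - d)}| = n.
Proof. by move=> dn; rewrite card_sum !card_ord subnKC. Qed.

(** * Comparison with K*_{d,n-d} *)

Section HeadTail.
Variables (n d : nat) (V : finType) (G : sgraph V).
Hypotheses (Gnd : min_degree_class n d G) (d_gt0 : 0 < d) (dn : 19 * d ^ 2 <= n).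

Local Notation a := (count_indep G setT).
Local Notation b := (count_indep (kstar d (n - d)) setT).

Let cardV : #|V| = n. Proof. by case: Gnd. Qed.

Let deg_ge v : d <= degree G v. Proof. by case: Gnd => _; apply. Qed.

Let dn_lt : d < n. Proof. by nia. Qed.

Let b0 : b 0 = 1. Proof. exact: count_indep0. Qed.

Let b1 : b 1 = n. Proof. by rewrite count_indep1 card_kstar_vertices // ltnW. Qed.

Let b_succ l : 1 < l -> l.+1 * b l.+1 = (n - d - l) * b l.
Proof. by move=> l1; rewrite !count_indep_kstar ?mul_bin_left // ltnW. Qed.

(** Both sequences have growth factor [(n - d - l) / l.+1], as an upper bound for [a] and exactly
    for [b]. *)
Lemma kstar_cross k l : 2 <= k <= l -> b k * a l <= a k * b l.
Proof.
move=> /andP[k2]; rewrite leq_eqVlt => /predU1P[<-|kl]; first by rewrite mulnC.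
rewrite -[leqLHS]mul1n.
apply: (@ratio_cross 1 a b (fun l => n - d - l) (fun l => n - d - l) k) => //= j kj.
- by rewrite -{1}cardV; apply: count_indep_succ; rewrite // (leq_trans _ kj) // ltnW.
- by apply: b_succ; exact: leq_trans kj.
- by rewrite mul1n.
Qed.

Lemma head_tail_small_alpha M t :
  independence_number G < n - d -> n < M -> t < M ->
  (\sum_(0 <= k < t.+1) b k) * (\sum_(t.+1 <= l < M) a l)
  <= (\sum_(0 <= k < t.+1) a k) * (\sum_(t.+1 <= l < M) b l).
Proof.
move=> alpha nM tM; apply: head_tail_cross_of_total => //.
- by rewrite b0 count_indep0.
- by rewrite b1 count_indep1.
- exact: kstar_cross.
- rewrite -!card_indeps ?cardV ?card_kstar_vertices // ?(ltnW dn_lt) //.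
  apply: leq_trans (card_indeps_kstar_ge d (n - d)); rewrite -cardV.
  by apply: card_indeps_le_exp; rewrite ?cardV //; nia.
Qed.

Lemma head_tail_ge2 M t : n < M -> t < M -> 1 < t ->
  (\sum_(0 <= k < t.+1) b k) * (\sum_(t.+1 <= l < M) a l)
  <= (\sum_(0 <= k < t.+1) a k) * (\sum_(t.+1 <= l < M) b l).
Proof.
move=> nM tM t1.
have [alpha|alpha] := ltnP (independence_number G) (n - d).
  exact: head_tail_small_alpha.
have [S indS maxS] := independent_max G.
have cardS : #|S| = #|V| - d.
  rewrite maxS cardV; apply/eqP; rewrite eqn_leq alpha andbT -cardV.
  by apply: independence_number_le; rewrite // cardV; lia.
have cardSC : #|~: S| = d by rewrite cardsCs setCK cardS cardV subKn // ltnW.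
(* Here alpha(G) = n-d, and the excess counts independent sets among the d vertices outside [S]. *)
apply: (@head_tail_cross_of_excess _ _ (count_indep G (~: S))) => //.
- by rewrite b0 count_indep0.
- by rewrite b1 count_indep1.
- move=> k k1; rewrite count_indep_kstar // -cardV.
  by apply: count_indep_extremal => //; rewrite ?cardV // ltnW.
- rewrite b0 b1 count_indep_kstar // bin2; nia.
- move=> k l /andP[k2 kl].
  apply: (@ratio_cross 2 _ b (fun l => d - l) (fun l => n - d - l) k) => // j kj.
  + by rewrite -[X in (X - _) * _]cardSC; exact: count_indep_succ_sub.
  + by apply: b_succ; exact: leq_trans kj.
  + nia.
Qed.

End HeadTail.

From mathcomp Require Import all_classical all_reals all_analysis.
Import Order.TTheory GRing.Theory Num.Theory.
Import numFieldNormedType.Exports.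

Local Open Scope classical_set_scope.
Local Open Scope ring_scope.

(** * Distribution functions as ratios of partial sums *)

Section Probability.
Variable R : realType.

Lemma card_indep_setT (V : finType) (G : sgraph V) :
  #|indep_set G| = #|indeps G (finset.setTfor V)|.
Proof. by rewrite card_sig; apply: eq_card => S; rewrite !inE finset.subsetT. Qed.

Lemma unif_pr_indep_size_le (V : finType) (G : sgraph V) (t : R) : 0 <= t ->
  unif_pr R (indep_set G) [pred S | indep_size R G S <= t] =
  (\sum_(0 <= k < (Num.truncn t).+1) count_indep G (finset.setTfor V) k)%N%:R
  / #|indeps G (finset.setTfor V)|%:R.
Proof.
move=> t0; rewrite /unif_pr card_indep_setT -card_indeps_lt.
rewrite -(card_indep_set G (fun S => #|S| < (Num.truncn t).+1)%N).
congr (_%:R / _); apply: eq_card => S; rewrite !inE /indep_size.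
by rewrite ltnS truncn_ge_nat.
Qed.

Lemma unif_pr_le0 (Omega : finType) (X : Omega -> R) (t x : R) :
  t < x -> (forall w, x <= X w) -> unif_pr R Omega [pred w | X w <= t] = 0.
Proof.
move=> tx xX; rewrite /unif_pr eq_card0 ?mul0r // => w.
by rewrite !inE; apply/negbTE; rewrite -ltNge (lt_le_trans tx).
Qed.

Lemma unif_pr_ge0 (Omega : finType) (E : pred Omega) : 0 <= unif_pr R Omega E.
Proof. by rewrite /unif_pr divr_ge0. Qed.

(** Each denominator is head plus tail. After cross-multiplication the product of the two heads
    cancels, leaving [cross]. *)
Lemma head_ratio_le (V W : finType) (G : sgraph V) (H : sgraph W) (M t : nat) :
  (#|V| < M)%N -> (#|W| < M)%N -> (t < M)%N ->
  let a := count_indep G (finset.setTfor V) in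
  let b := count_indep H (finset.setTfor W) in
  ((\sum_(0 <= k < t.+1) b k) * (\sum_(t.+1 <= l < M) a l)
    <= (\sum_(0 <= k < t.+1) a k) * (\sum_(t.+1 <= l < M) b l))%N ->
  (\sum_(0 <= k < t.+1) b k)%N%:R / #|indeps H (finset.setTfor W)|%:R
    <= (\sum_(0 <= k < t.+1) a k)%N%:R / #|indeps G (finset.setTfor V)|%:R :> R.
Proof.
move=> VM WM tM a b cross.
have gt0 (U : finType) (K : sgraph U) : 0 < #|indeps K (finset.setTfor U)|%:R :> R.
  rewrite ltr0n; apply/card_gt0P; exists finset.set0.
  by rewrite inE finset.sub0set; apply/independentP => u v; rewrite inE.
rewrite ler_pdivrMr // mulrAC ler_pdivlMr // -!natrM ler_nat.
rewrite (card_indeps G _ VM) (card_indeps H _ WM) -/a -/b.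
rewrite !(@big_cat_nat _ _ _ t.+1 0 M) //=.
by rewrite [leqLHS]mulnDr [leqRHS]mulnDr [X in (X + _ <= _)%N]mulnC leq_add2l.
Qed.

End Probability.

Lemma littleo_cube_root (R : realType) (d : nat -> nat) (c : nat) :
  (fun n : nat => (d n)%:R : R) =o_\oo (fun n : nat => n%:R `^ (1 / 3) : R) ->
  exists N, forall n, (N <= n)%N -> (c * d n ^ 2 <= n)%N.
Proof.
(* Taking epsilon = 1 gives d^3 <= n eventually. If c <= d then c d^2 <= d^3 <= n; otherwise c d^2
   <= c^3 <= n. *)
move=> /eqoP /(_ 1 ltr01) [N _ hN]; exists (maxn N (c ^ 3)) => n.
rewrite geq_max => /andP[/hN /= + cn].
rewrite mul1r normr_nat ger0_norm ?powR_ge0 // => le.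
have : (d n)%:R ^+ 3 <= (n%:R `^ (1 / 3)) ^+ 3 :> R by rewrite lerXn2r ?nnegrE ?powR_ge0.
rewrite -[leRHS]powR_mulrn ?powR_ge0 // -powRrM divfK ?pnatr_eq0 // powRr1 //.
rewrite -natrX ler_nat => dn.
have [cd|/ltnW dc] := leqP c (d n).
  by apply: leq_trans dn; rewrite [leqRHS]expnS leq_mul2r cd orbT.
by apply: leq_trans cn; rewrite [leqRHS]expnS leq_mul2l leq_exp2r // dc orbT.
Qed.

Theorem corollary3 (R : realType) (d : nat -> nat)
    (d_ge1 : forall n : nat, (1 <= d n)%N)
    (d_small : (fun n : nat => (d n)%:R : R)
                 =o_\oo (fun n : nat => n%:R `^ (1 / 3) : R)) :
  exists N : nat, forall n : nat, (N <= n)%N ->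
    forall (V : finType) (G : sgraph V), min_degree_class n (d n) G ->
      stoch_le (indep_size R G)
        (fun S => Num.max 2 (indep_size R (kstar (d n) (n - d n)) S))
      /\ ((independence_number G < n - d n)%N ->
          stoch_le (indep_size R G) (indep_size R (kstar (d n) (n - d n)))).
Proof.
(* As d >= 1, the bound 19 d^2 <= n gives the strict 18 d^2 < n needed by [card_indeps_le_exp]. *)
have [N hN] := @littleo_cube_root R d 19 d_small; exists N => n /hN dn V G Gnd.
have d0 := d_ge1 n; have cardK : #|{: 'I_(d n) + 'I_(n - d n)}| = n.
  by apply: card_kstar_vertices; nia.
have [cardV _] := Gnd.
(* [M] exceeds both n and the integer part of [t], so sums below [M] count all independent sets and
   the split point lies inside the range. *)
have dominated (t : R) (M := (n + Num.truncn t).+1) : 0 <= t ->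
    ((\sum_(0 <= k < (Num.truncn t).+1) count_indep (kstar (d n) (n - d n)) (finset.setTfor _) k)
       * (\sum_((Num.truncn t).+1 <= l < M) count_indep G (finset.setTfor _) l)
     <= (\sum_(0 <= k < (Num.truncn t).+1) count_indep G (finset.setTfor _) k)
       * (\sum_((Num.truncn t).+1 <= l < M)
            count_indep (kstar (d n) (n - d n)) (finset.setTfor _) l))%N ->
    unif_pr R _ [pred S | indep_size R (kstar (d n) (n - d n)) S <= t]
      <= unif_pr R _ [pred S | indep_size R G S <= t].
  move=> t0 cross; rewrite !unif_pr_indep_size_le //.
  by apply: head_ratio_le cross; rewrite ?cardV ?cardK ltnS ?leq_addr ?leq_addl.
split=> [t|alpha t].
  (* Below 2 the maximum never falls under the threshold, so its distribution function is 0
     there. *)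
  have [t2|t2] := ltP t 2.
    by rewrite (@unif_pr_le0 _ _ _ _ _ t2) ?unif_pr_ge0 // => S; rewrite le_max lexx.
  have t0 : 0 <= t by apply: le_trans t2.
  have -> : unif_pr R _ [pred S | Num.max 2 (indep_size R (kstar (d n) (n - d n)) S) <= t]
      = unif_pr R _ [pred S | indep_size R (kstar (d n) (n - d n)) S <= t].
    by congr (_%:R / _); apply: eq_card => S; rewrite !inE ge_max t2.
  apply: dominated => //; apply: head_tail_ge2; rewrite ?ltnS ?leq_addr ?leq_addl //.
  by rewrite truncn_ge_nat.
have [t0|t0] := ltP t 0.
  by rewrite (@unif_pr_le0 _ _ _ _ _ t0) ?unif_pr_ge0 // => S; exact: ler0n.
by apply: dominated => //; apply: head_tail_small_alpha; rewrite ?ltnS ?leq_addr ?leq_addl.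
Qed.
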